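(* Let $A$ and $H$ be finite abelian groups, let $\phi:H\to\operatorname{Aut}(A)$ be a group homomorphism, and let $G=A\rtimes_\phi H$, regarded as a subgroup of the symmetric group $S_m$ (i.e. $G\le S_m$ is a subgroup isomorphic to $A\rtimes_\phi H$). Let $V$ be a complex inner product space with $\dim V=n>1$ and a fixed orthonormal basis $\{e_1,\dots,e_n\}$, and let $\chi$ be an irreducible complex character of $G$. Suppose that there is $\alpha\in\Gamma_{m,n}$ such that $G_\alpha=\{e\}$ and that $|H|\notin\mathbb{N}_0\langle\operatorname{Prime}(|A|)\rangle$. Then $V_\chi(G)$ admits an o*-basis if and only if $\chi$ is linear (i.e. $\chi(e)=1$).
   Context: Semi-direct product: $A\rtimes_\phi H$ is the set $\{(a,h): a\in A,h\in H\}$ with multiplication $(a_1,h_1)(a_2,h_2)=(a_1\phi_{h_1}(a_2),h_1h_2)$, where $\phi_h=\phi(h)$. $\Gamma_{m,n}$ is the set of all sequences $\alpha=(\alpha_1,\dots,\alpha_m)$ of integers with $1\le\alpha_i\le n$. For a subgroup $G\le S_m$, and $\alpha\in\Gamma_{m,n}$, $\alpha\sigma=(\alpha_{\sigma^{-1}(1)},\dots,\alpha_{\sigma^{-1}(m)})$ for $\sigma\in G$, and $G_\alpha=\{\sigma\in G:\alpha\sigma=\alpha\}$ is the stabilizer of $\alpha$; $e$ is the identity of $G$. The tensor power $V^{\otimes m}$ carries the induced inner product, for which the tensors $e^\otimes_\alpha=e_{\alpha_1}\otimes\cdots\otimes e_{\alpha_m}$, $\alpha\in\Gamma_{m,n}$,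 form an orthonormal basis. For $\sigma\in G$, $P_\sigma$ is the linear operator on $V^{\otimes m}$ with $P_\sigma(v_1\otimes\cdots\otimes v_m)=v_{\sigma^{-1}(1)}\otimes\cdots\otimes v_{\sigma^{-1}(m)}$. For an irreducible complex character $\chi$ of $G$, put $$T(G,\chi)=\frac{\chi(e)}{|G|}\sum_{\sigma\in G}\chi(\sigma)P_\sigma .$$ The symmetry class of tensors $V_\chi(G)$ is the image of $T(G,\chi)$ on $V^{\otimes m}$, with the inner product restricted from $V^{\otimes m}$. Write $e^*_\alpha=T(G,\chi)(e^\otimes_\alpha)$ for $\alpha\in\Gamma_{m,n}$. An o*-basis (orthogonal $\ast$-basis) of $V_\chi(G)$ is an orthogonal basis of $V_\chi(G)$ all of whose elements are of the form $e^*_\gamma$ with $\gamma\in\Gamma_{m,n}$. For a positive integer $N$, $\operatorname{Prime}(N)$ is the set of all prime factors of $N$. $\mathbb{N}_0$ is the set of nonnegative integers, and for a finite set of primes $\{p_1,\dots,p_t\}$, $\mathbb{N}_0\langle\{p_1,\dots,p_t\}\rangle=\{k_1p_1+\cdots+k_tp_t: k_i\in\mathbb{N}_0\}$. *)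

(* Defs.v *)
From HB Require Import structures.
From mathcomp Require Import all_boot all_order all_algebra all_fingroup.
From mathcomp Require Import mxrepresentation sesquilinear boolp.

Set Implicit Arguments.
Unset Strict Implicit.
Unset Printing Implicit Defensive.

Import Order.TTheory GRing.Theory Num.Theory.
Local Open Scope ring_scope.

(* MathComp composes permutations from left to right, so that the morphism    *)
(* phi below satisfies phi (h * k) = (phi k) \o (phi h); this agrees with the *)
(* usual convention for a homomorphism H -> Aut(A) whenever H is abelian.     *)
Section SemidirectProduct.
Variables (aT hT gT : finGroupType) (A : {group aT}) (H : {group hT}).
Variable phi : {morphism H >-> {perm aT}}.

Definition sdprod_law (u v : aT * hT) : aT * hT :=
  (u.1 * phi u.2 v.1, u.2 * v.2)%g.

Definition isog_sdprod (G : {set gT}) : Prop :=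
  exists f : aT * hT -> gT,
    [/\ {in setX A H &, injective f},
        f @: setX A H = G
      & {in setX A H &, forall u v, f (sdprod_law u v) = (f u * f v)%g}].
End SemidirectProduct.

(* [chi] is only constrained on [G]. *)
Definition irr_character (C : fieldType) (gT : finGroupType) (G : {group gT})
    (chi : gT -> C) : Prop :=
  exists (d : nat) (rG : mx_representation C G d),
    mx_irreducible rG /\ {in G, forall g, chi g = \tr (rG g)}.

Definition nat_span (s : seq nat) (N : nat) : Prop :=
  exists k : nat -> nat, N = (\sum_(p <- s) k p * p)%N.

Definition place_fun (m : nat) (T : Type) (v : {ffun 'I_m -> T}) (s : 'S_m)
    : {ffun 'I_m -> T} :=
  [ffun i => v ((s^-1)%g i)].

Notation Gamma m n := {ffun 'I_m -> 'I_n}.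

Definition stab_seq (m n : nat) (G : {set 'S_m}) (alpha : Gamma m n) :
    {set 'S_m} :=
  [set s in G | place_fun alpha s == alpha].

Section TensorPower.
Variables (C : numClosedFieldType) (V : vectType C) (m : nat).

Definition set_slot (v : {ffun 'I_m -> V}) (i : 'I_m) (x : V) :=
  [ffun j => if j == i then x else v j].

Definition multilinear (U : vectType C) (f : {ffun 'I_m -> V} -> U) : Prop :=
  forall (v : {ffun 'I_m -> V}) (i : 'I_m),
    linear (fun x => f (set_slot v i x)).

(* The m-th tensor power of (V, ip): the universal multilinear map            *)
(* (v_1, ..., v_m) |-> v_1 (x) ... (x) v_m, and the induced inner product.    *)
Record tensor_power (ip : {dot V for Num.conj}) := TensorPower {
  tp_space :> vectType C;
  tp_dot : {dot tp_space for Num.conj};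
  pure : {ffun 'I_m -> V} -> tp_space;
  pure_multilinear : multilinear pure;
  pure_universal : forall (U : vectType C) (f : {ffun 'I_m -> V} -> U),
    multilinear f -> exists! g : 'Hom(tp_space, U), forall v, g (pure v) = f v;
  tp_dot_pure : forall u v : {ffun 'I_m -> V},
    tp_dot (pure u) (pure v) = \prod_(i < m) ip (u i) (v i)
}.

Variables (ip : {dot V for Num.conj}) (W : tensor_power ip).

Lemma multilinear_place (s : 'S_m) :
  multilinear (fun v => pure W (place_fun v s)).
Proof.
move=> v i a x y; have E z : place_fun (set_slot v i z) s =
    set_slot (place_fun v s) (s i) z.
  by apply/ffunP=> j; rewrite !ffunE (canF_eq (permKV s)).
by rewrite !E pure_multilinear.
Qed.

Definition place_perm (s : 'S_m) : 'End(W) :=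
  sval (cid (pure_universal W (@multilinear_place s))).

Lemma place_permE (s : 'S_m) (v : {ffun 'I_m -> V}) :
  place_perm s (pure W v) = pure W (place_fun v s).
Proof. by rewrite /place_perm; case: cid => g [/= gE _]. Qed.

Section SymmetryClass.
Variables (G : {set 'S_m}) (chi : 'S_m -> C).

Definition symmetrizer : 'End(W) :=
  (chi 1%g / #|G|%:R) *: \sum_(s in G) chi s *: place_perm s.

Definition symmetry_class : {vspace W} := limg symmetrizer.

Variables (n : nat) (e : n.-tuple V).

Definition basis_tensor (alpha : Gamma m n) : W :=
  pure W [ffun i => tnth e (alpha i)].

Definition star_tensor (alpha : Gamma m n) : W :=
  symmetrizer (basis_tensor alpha).

Definition has_ostar_basis : Prop :=
  exists s : seq (Gamma m n), let X := [seq star_tensor gamma | gamma <- s] in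
    basis_of symmetry_class X /\ pairwise_orthogonal (tp_dot W) X.
End SymmetryClass.
End TensorPower.

(* Existence of the tensor power, realized on functions Gamma m n -> C; this  *)
(* is not used in the definitions above.                                      *)
Section Multilinear.
Variables (C : numClosedFieldType) (V : vectType C) (m n : nat).
Variables (e : n.-tuple V) (e_basis : basis_of {:V}%VS e).

Lemma set_slot_id (v : {ffun 'I_m -> V}) i : set_slot v i (v i) = v.
Proof. by apply/ffunP=> j; rewrite ffunE; case: eqP => [->|]. Qed.

Lemma multilinear_eq (U : vectType C) (f g : {ffun 'I_m -> V} -> U) :
  multilinear f -> multilinear g ->
  (forall alpha : Gamma m n, f [ffun i => tnth e (alpha i)] =
                             g [ffun i => tnth e (alpha i)]) ->
  f =1 g.
Proof.
move=> fL gL fg v.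
suff: forall k, (k <= m)%N -> forall v : {ffun 'I_m -> V},
    (forall i : 'I_m, (k <= i)%N -> exists j, v i = tnth e j) -> f v = g v.
  by apply; [exact: leqnn | move=> i]; rewrite leqNgt ltn_ord.
elim=> [_ {}v|k IHk km {}v] ve.
  have [a va] := choice (fun i => ve i (leq0n i)).
  by have := fg [ffun i => a i]; congr (f _ = g _); apply/ffunP=> i; rewrite !ffunE va.
pose i0 := Ordinal km.
have [FL GL] := (fL v i0, gL v i0).
pose Fm := HB.pack_for {linear V -> U} (fun x => f (set_slot v i0 x))
  (GRing.isLinear.Build _ _ _ _ _ FL).
pose Gm := HB.pack_for {linear V -> U} (fun x => g (set_slot v i0 x))
  (GRing.isLinear.Build _ _ _ _ _ GL).
rewrite -(set_slot_id v i0).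
change (Fm (v i0) = Gm (v i0)).
rewrite (coord_basis e_basis (memvf (v i0))) !linear_sum; apply: eq_bigr => j _.
rewrite !linearZ /=; congr (_ *: _).
have -> : e`_j = tnth e j by rewrite (tnth_nth 0).
apply: IHk => [|i ki]; first exact: ltnW.
rewrite ffunE; case: eqP => [_|/eqP ni]; first by exists j.
apply: ve; rewrite ltn_neqAle ki andbT.
by apply: contra ni => /eqP ki'; apply/eqP/val_inj.
Qed.
End Multilinear.

Section Model.
Variables (C : numClosedFieldType) (V : vectType C) (m n : nat).
Variables (ip : {dot V for Num.conj}) (e : n.-tuple V).
Variables (e_basis : basis_of {:V}%VS e) (e_on : orthonormal ip e).

Let W : vectType C := {ffun Gamma m n -> C^o}.
Definition coord_dot (u v : W) : C := \sum_a (u a : C) * (v a : C)^*.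

Fact coord_dot_bilin : bilinear_for *%R (Num.conj \; *%R) coord_dot.
Proof.
split=> u c x y; rewrite /coord_dot /= mulr_sumr -big_split; apply: eq_bigr => a _.
  by rewrite !ffunE mulrDl mulrA.
by rewrite !ffunE rmorphD rmorphM mulrDr /= mulrCA.
Qed.
Fact coord_dot_herm (x y : W) : coord_dot x y = (-1) ^+ false * (coord_dot y x)^*.
Proof.
rewrite mul1r /coord_dot rmorph_sum; apply: eq_bigr => a _.
by rewrite /= rmorphM /= conjCK mulrC.
Qed.
Fact coord_dot_pos (x : W) : x != 0 -> 0 < coord_dot x x.
Proof.
move=> nz; have P a : true -> 0 <= (x a : C) * (x a : C)^* by rewrite mul_conjC_ge0.
rewrite lt_neqAle sumr_ge0 // andbT eq_sym; apply: contra nz => /eqP E.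
apply/eqP/ffunP=> a; have := psumr_eq0P P E; move=> /(_ a isT)/eqP.
by rewrite mul_conjC_eq0 ffunE => /eqP.
Qed.
HB.instance Definition _ := bilinear_isBilinear.Build C W W C *%R
  (Num.conj \; *%R) coord_dot coord_dot_bilin.
HB.instance Definition _ := isHermitianSesquilinear.Build C W false Num.conj coord_dot coord_dot_herm.
HB.instance Definition _ := isDotProduct.Build C W coord_dot coord_dot_pos.
Definition coord_dotW : {dot W for Num.conj} := coord_dot.

Definition coord_pure (v : {ffun 'I_m -> V}) : W :=
  [ffun a : Gamma m n => \prod_i coord e (a i) (v i) : C^o].

Lemma coord_pure_multi : multilinear coord_pure.
Proof.
move=> v i c x y; apply/ffunP=> a; rewrite !ffunE.
pose P := \prod_(j | j != i) coord e (a j) (v j).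
have E z : \prod_j coord e (a j) (set_slot v i z j) = coord e (a i) z * P.
  rewrite (bigD1 i) //= ffunE eqxx; congr (_ * _).
  by apply: eq_bigr => j ji; rewrite ffunE (negPf ji).
by rewrite !E linearP mulrDl; congr (_ + _); rewrite -mulrA.
Qed.

Lemma coord_pure_e (a b : Gamma m n) :
  coord_pure [ffun i => tnth e (a i)] b = (a == b)%:R :> C.
Proof.
rewrite !ffunE; have [<-|/eqP ab] := eqP.
  rewrite big1 // => i _; rewrite !ffunE (tnth_nth 0) coord_free ?eqxx //.
  exact: basis_free e_basis.
have [i abi] : exists i, a i != b i.
  by apply/existsP; apply: contraR ab => /existsPn ab; apply/eqP/ffunP=> i;
     apply/eqP/negbNE.
rewrite (bigD1 i) //= ffunE (tnth_nth 0) coord_free ?(basis_free e_basis) //.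
by rewrite (negPf abi) mul0r.
Qed.

Lemma coord_space_sum (w : W) : w = \sum_a (w a : C) *: coord_pure [ffun i => tnth e (a i)].
Proof.
apply/ffunP=> b; rewrite sum_ffunE (bigD1 b) //= big1 => [|a ab].
  by rewrite addr0 ffunE coord_pure_e eqxx [RHS]mulr1.
by rewrite ffunE coord_pure_e (negPf ab); exact: mulr0.
Qed.

Lemma coord_pure_univ (U : vectType C) (f : {ffun 'I_m -> V} -> U) : multilinear f ->
  exists! g : 'Hom(W, U), forall v, g (coord_pure v) = f v.
Proof.
move=> fL.
pose g0 (w : W) := \sum_(a : Gamma m n) (w a : C) *: f [ffun i => tnth e (a i)].
have g0L : linear g0.
  move=> c x y; rewrite /g0 scaler_sumr -big_split; apply: eq_bigr => a _.
  by rewrite !ffunE scalerDl scalerA.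
pose g1 := HB.pack_for {linear W -> U} g0 (GRing.isLinear.Build _ _ _ _ _ g0L).
exists (linfun g1); split=> [|g' g'E].
  apply: (multilinear_eq e_basis) => // [v i c x y|a].
    by rewrite coord_pure_multi linearP.
  rewrite lfunE /= /g0 (bigD1 a) //= coord_pure_e eqxx scale1r big1 ?addr0 // => b ba.
  by rewrite coord_pure_e eq_sym (negPf ba) scale0r.
apply/lfunP=> w; rewrite lfunE /= /g0 {2}(coord_space_sum w) linear_sum; apply: eq_bigr => a _.
by rewrite linearZ /= g'E.
Qed.

Lemma coord_pure_dot (u v : {ffun 'I_m -> V}) :
  coord_dotW (coord_pure u) (coord_pure v) = \prod_i ip (u i) (v i).
Proof.
have eE (j k : 'I_n) : ip e`_j e`_k = (j == k)%:R.
  case/orthonormalP: e_on => ue ->; try by apply/mem_nth; rewrite size_tuple.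
  by rewrite nth_uniq ?size_tuple.
have E x y : ip x y = \sum_j coord e j x * (coord e j y)^*.
  rewrite {1}(coord_basis e_basis (memvf x)) linear_sumlz /=; apply: eq_bigr => j _.
  rewrite linearZl_LR /=; congr (_ * _).
  rewrite {1}(coord_basis e_basis (memvf y)) linear_sumr (bigD1 j) //= big1.
    by rewrite linearZr_LR /= addr0 eE eqxx mulr1.
  by move=> k kj; rewrite linearZr_LR /= eE eq_sym (negPf kj) mulr0.
under [RHS]eq_bigr do rewrite E.
rewrite bigA_distr_bigA; apply: eq_bigr => a _.
by rewrite !ffunE rmorph_prod -big_split.
Qed.

Definition coord_tensor_power : tensor_power m ip :=
  TensorPower coord_pure_multi coord_pure_univ coord_pure_dot.
End Model.

(* Main.v *)
Require Import Defs.
From mathcomp Require Import all_boot all_order all_algebra all_fingroup.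
From mathcomp Require Import cyclotomic algC commutator cyclic separable.
From mathcomp Require Import mxrepresentation sesquilinear reals complex.

(* Let [r] be the representation affording [chi], of degree [d]. By Schur's       *)
(* lemma the average of [r a] over the [H]-conjugates of [a] in [A] is a scalar,  *)
(* so evaluating it on a common eigenvector of [A] shows that [|H| chi(a) / d] is *)
(* a sum of [|H|] roots of unity of order dividing [|A|]. The theorem of Lam and  *)
(* Leung and the hypothesis on [|H|] make [chi] nonvanishing on [A]. Moreover     *)
(* [chi(a h) = 0] unless [r h] is scalar, so the support of [chi] is a subgroup   *)
(* containing [A]. On the orbit of an [alpha] with trivial stabilizer the star    *)
(* tensors of [alpha x] and [alpha y] are orthogonal iff [chi(x^-1 y) = 0]. Hence *)
(* in the span of an orthogonal *-basis, the star tensors of one coset of the     *)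
(* support are all proportional, which forces [r a] to be scalar for [a] in [A];  *)
(* then [r] is scalar on [H] as well, and [d = 1].                                *)

(** For the forward implication, [lam_leung] gives [char_abelian_normal_neq0], and [char_coset_eq0]
    then determines the support of the character in [char_neq0P]. [star_tensor_dot_regular]
    translates this into orthogonality on the regular orbit, [ostar_basis_orbit] extracts the
    proportionality, and [ostar_basis_linear] concludes. For the converse, star tensors of different
    orbits are always orthogonal, and a multiplicative [chi] makes those of a single orbit
    proportional. Choosing one representative per orbit and discarding the zero tensors leaves an
    orthogonal basis ([linear_ostar_basis]). *)

Set Implicit Arguments.
Unset Strict Implicit.
Unset Printing Implicit Defensive.

Import Order.TTheory GRing.Theory Num.Theory.
Local Open Scope ring_scope.

(** * Vanishing sums of roots of unity *)

(** Take for [x] a root in [C] of the rational minimal polynomial of [w]: cyclotomic facts about [w]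
    then carry over to [C]. *)
Lemma prim_root_transfer (C : numClosedFieldType) (N : nat) (w : algC) :
  N.-primitive_root w ->
  exists x : C, forall f : {poly rat},
    root (map_poly ratr f) x = root (map_poly ratr f) w.
Proof.
move=> w_prim; have [p [Dp p_mon] p_min] := minCpolyP w.
have p_size : (1 < size p)%N by have := size_minCpoly w; rewrite Dp size_map_poly.
have [|x px] := closed_rootP (map_poly ratr p : {poly C}) _.
  by rewrite size_map_poly neq_ltn p_size orbT.
have p_root_w : root (map_poly ratr p) w by rewrite -Dp root_minCpoly.
exists x => f; rewrite p_min; apply/idP/idP => [fx|/dvdpP[q ->]]; last first.
  by rewrite rmorphM rootM px orbT.
(* Write [p = h * g]. By minimality [p] divides [g], hence [f], or it divides [h]; in the second
   case [g] is constant, so [p] and [f] are coprime and cannot share the root [x]. *)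
set g := gcdp p f; have [h Dh] := dvdpP _ _ (dvdp_gcdl p f).
have : root (map_poly ratr (h * g)) w by rewrite -Dh.
rewrite rmorphM rootM !p_min => /orP[ph|pg]; last first.
  exact: dvdp_trans pg (dvdp_gcdr p f).
have h_neq0 : h != 0 by apply/eqP=> h0; move: p_size;
  rewrite Dh h0 mul0r size_poly0.
have : coprimep p f.
  rewrite coprimep_def; have := dvdp_leq h_neq0 ph; rewrite {1}Dh.
  have g_neq0 : g != 0 by apply/eqP=> g0; move: p_size;
    rewrite Dh -/g g0 mulr0 size_poly0.
  rewrite size_mul // -/g; move: h_neq0 g_neq0; rewrite -!size_poly_gt0.
  by case: (size h) (size g) => [|a] [|[|b]] //= _ _;
    rewrite !addnS /= ltnNge leq_addr.
rewrite -(coprimep_map (ratr : {rmorphism rat -> C}) p f) => /coprimep_root.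
by move=> /(_ x px); rewrite (rootP fx) eqxx.
Qed.

(** All terms are powers of one primitive root [x], so the sum is [f(x)] with [f] rational. Since
    [x ^+ j] is a root of the same cyclotomic polynomial, [f(x ^+ j) = 0]. *)
Lemma sum_unity_roots_exp (C : numClosedFieldType) (N j : nat) (s : seq C) :
  (0 < N)%N -> coprime j N -> all N.-unity_root s ->
  \sum_(z <- s) z = 0 -> \sum_(z <- s) z ^+ j = 0.
Proof.
move=> N_gt0 co_jN s_unity s_sum0.
have [w w_prim] := C_prim_root_exists N_gt0.
have [x root_x] := prim_root_transfer C w_prim.
have rootXn1 (F : numFieldType) (y : F) k :
    root (map_poly ratr ('X^k - 1)) y = (y ^+ k == 1).
  by rewrite rmorphB /= map_polyXn rmorph1 /root !hornerE subr_eq0.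
have x_order k : (x ^+ k == 1) = (w ^+ k == 1) by rewrite -!rootXn1 root_x.
have x_prim : N.-primitive_root x.
  apply/andP; split=> //; apply/forallP => k;
    move: w_prim => /andP[_ /forallP/(_ k)].
  by rewrite !unity_rootE x_order.
have root_exp (f : {poly rat}) :
    root (map_poly ratr f) x -> root (map_poly ratr f) (x ^+ j).
  have comp (F : numFieldType) (y : F) :
      root (map_poly ratr (f \Po 'X^j)) y = root (map_poly ratr f) (y ^+ j).
    by rewrite map_comp_poly map_polyXn root_comp !hornerE.
  rewrite -comp !root_x comp; have [p [Dp _] p_min] := minCpolyP w.
  rewrite p_min => /dvdpP[q ->]; rewrite rmorphM rootM; apply/orP; right.
  by rewrite /= -Dp (minCpoly_cyclotomic w_prim) root_cyclotomic //
    prim_root_exp_coprime.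
have [a Da] : exists a : seq nat, s = [seq x ^+ i | i <- a].
  elim: s {s_sum0} s_unity => [|z s IHs] /=; first by exists [::].
  case/andP=> /unity_rootP zN /IHs[a ->]; have [i ->] := prim_rootP x_prim zN.
  by exists (val i :: a).
pose f : {poly rat} := \sum_(i <- a) 'X^i.
have f_horner y : (map_poly ratr f).[y] = \sum_(i <- a) y ^+ i :> C.
  by rewrite rmorph_sum horner_sum; apply: eq_bigr => i _;
    rewrite /= map_polyXn !hornerE.
have := root_exp f; rewrite /root !f_horner; move: s_sum0;
  rewrite Da !big_map => ->.
move=> /(_ (eqxx _))/eqP fxj; rewrite -[RHS]fxj; apply: eq_bigr => i _.
by rewrite -!exprM mulnC.
Qed.

(* The coefficients of [P] are, up to sign, the elementary symmetric functions.  *)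
Lemma newton_identity (F : fieldType) (s : seq F) (l : nat)
    (P := \prod_(z <- s) (1 - z *: 'X)) :
  P`_l.+1 *+ l.+1 = - \sum_(t < l.+1) (\sum_(z <- s) z ^+ t.+1) * P`_(l - t).
Proof.
rewrite -coef_deriv /P {P}; elim: s l => [|z s IHs] l.
  rewrite big_nil derivC coef0 big1 ?oppr0 // => t _.
  by rewrite !big_nil mul0r.
set Q := \prod_(y <- s) _ in IHs *; rewrite big_cons -/Q; set P := _ * Q.
have P_coef k : P`_k = Q`_k - (if k is i.+1 then z * Q`_i else 0).
  by rewrite /P mulrBl mul1r -scalerAl coefB coefZ coefXM; case: k => //=;
    rewrite mulr0.
(* [Q] is [P] divided by [1 - z *: 'X], that is, [P] times a geometric series. *)
have Q_coef k : \sum_(t < k.+1) z ^+ t * P`_(k - t) = Q`_k.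
  elim: k => [|k IHk]; first by rewrite big_ord1 P_coef subr0 mul1r.
  rewrite big_ord_recl P_coef mul1r subn0 /=.
  under eq_bigr do rewrite exprS -mulrA subSS.
  by rewrite -mulr_sumr IHk subrK.
rewrite {1}/P derivM derivB derivC derivZ derivX alg_polyC sub0r mulNr mul_polyC.
rewrite coefD coefN coefZ.
under eq_bigr do rewrite big_cons mulrDl exprS -mulrA.
rewrite big_split /= -mulr_sumr Q_coef opprD; congr (_ + _).
rewrite mulrBl mul1r -scalerAl coefB coefZ coefXM IHs.
case: l => [|l] /=.
  by rewrite mulr0 subr0 !big_ord1 P_coef subr0.
rewrite IHs mulrN opprK mulr_sumr addrC.
rewrite [X in _ - X]big_ord_recr [in RHS]big_ord_recr /= subnn P_coef subr0.
rewrite !opprD addrA; congr (_ - _).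
rewrite -opprB; congr (- _); rewrite -sumrB; apply: eq_bigr => t _.
by rewrite subSn 1?P_coef ?mulrBr 1?mulrCA // -ltnS.
Qed.

Lemma nat_spanD (s : seq nat) (a b : nat) :
  nat_span s a -> nat_span s b -> nat_span s (a + b).
Proof.
move=> [k ->] [l ->]; exists (fun p => k p + l p)%N.
by rewrite -big_split; apply: eq_bigr => p _; rewrite mulnDl.
Qed.

Lemma nat_spanMl (s : seq nat) (a b : nat) : nat_span s a -> nat_span s (b * a).
Proof.
by move=> [k ->]; exists (fun p => b * k p)%N; rewrite big_distrr;
  apply: eq_bigr => p _; rewrite /= mulnA.
Qed.

Lemma nat_span_mem (s : seq nat) (p : nat) : uniq s -> p \in s -> nat_span s p.
Proof.
move=> s_uniq ps; exists (fun q => (q == p)%N).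
rewrite (bigD1_seq p) //= eqxx mul1n big1 ?addn0 // => q /negPf ->.
exact: mul0n.
Qed.

(* Lam-Leung. Their theorem follows from Newton's identities: the [j]-th power    *)
(* sum vanishes for [j] coprime to [N], by Galois conjugation, so a nonzero       *)
(* elementary symmetric function of [s] has its degree in the span; the last one, *)
(* of degree [size s], is nonzero.                                                *)
Lemma lam_leung (C : numClosedFieldType) (N : nat) (s : seq C) :
  (0 < N)%N -> all N.-unity_root s -> \sum_(z <- s) z = 0 ->
  nat_span (primes N) (size s).
Proof.
move=> N_gt0 s_unity s_sum0; pose P := \prod_(z <- s) (1 - z *: 'X).
have powersum_neq0 t : \sum_(z <- s) z ^+ t.+1 != 0 -> nat_span (primes N) t.+1.
  have [co_tN|] := boolP (coprime t.+1 N).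
    by rewrite (sum_unity_roots_exp N_gt0) ?eqxx.
  rewrite /coprime => g_neq1 _.
  set g := gcdn t.+1 N; have g_gt0 : (0 < g)%N by rewrite gcdn_gt0.
  have g_gt1 : (1 < g)%N by rewrite ltn_neqAle eq_sym g_neq1.
  have pN : pdiv g \in primes N.
    by rewrite mem_primes pdiv_prime // N_gt0 (dvdn_trans (pdiv_dvd _)
      (dvdn_gcdr _ _)).
  have /dvdnP[b ->] := dvdn_trans (pdiv_dvd g) (dvdn_gcdl t.+1 N).
  exact/nat_spanMl/nat_span_mem/pN/primes_uniq.
have coef_span k : P`_k != 0 -> nat_span (primes N) k.
  elim/ltn_ind: k => -[_ _|k IHk Pk].
    by exists (fun=> 0%N); rewrite big1.
  have : P`_k.+1 *+ k.+1 != 0 by rewrite -mulr_natr mulf_neq0 // pnatr_eq0.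
  rewrite newton_identity oppr_eq0 => nz.
  (* Some term of Newton's sum is nonzero, and its two indices [t.+1] and [k - t] add up to
     [k.+1]. *)
  have [t] : exists t : 'I_k.+1, (\sum_(z <- s) z ^+ t.+1) * P`_(k - t) != 0.
    apply/existsP; apply: contraNT nz => /existsPn all0.
    by apply/eqP/big1 => t _; apply/eqP/negbNE/all0.
  rewrite mulf_eq0 negb_or => /andP[/powersum_neq0 span_t /IHk span_k].
  have -> : k.+1 = (t.+1 + (k - t))%N by rewrite addSn subnKC // -ltnS.
  by apply: nat_spanD => //; apply: span_k; rewrite ltnS leq_subr.
have {s_sum0 powersum_neq0} : all (fun z => z != 0) s.
  apply: sub_all s_unity => z /unity_rootP; apply: contra_eqN => /eqP ->.
  by rewrite expr0n gtn_eqF // eq_sym oner_neq0.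
move=> s_neq0; apply: coef_span; rewrite /P {P s_unity}.
suff : size (\prod_(z <- s) (1 - z *: 'X)) = (size s).+1.
  by move=> sz; rewrite -[size s]/(size s).+1.-1 -sz -lead_coefE lead_coef_eq0
    -size_poly_eq0 sz.
elim: s s_neq0 => [|z s IHs] /=; first by rewrite big_nil size_poly1.
case/andP=> z_neq0 /IHs sz; rewrite big_cons.
have sz1 : size (1 - z *: 'X) = 2.
  rewrite addrC size_polyDl size_polyN size_scale // size_polyX //.
  by rewrite size_poly1.
rewrite size_mul ?sz1 ?sz // -size_poly_eq0 ?sz1 ?sz //.
Qed.

(** * Representations of an abelian-by-abelian group *)

Section ClosedFieldRepresentation.
Variables (C : numClosedFieldType) (gT : finGroupType) (G : {group gT}).
Variables (d : nat) (rG : mx_representation C G d).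
Hypothesis rG_irr : mx_irreducible rG.

Lemma mx_irr_degree_gt0 : (0 < d)%N.
Proof. by have [] := (mx_irrP rG).1 rG_irr. Qed.

(** Schur's lemma: for an eigenvalue [c] of [f], the matrix [f - c%:M] also commutes with the
    representation and is singular, so it vanishes. *)
Lemma centgmx_scalar (f : 'M[C]_d) : centgmx rG f -> exists c, f = c%:M.
Proof.
move=> f_cent; have [c f_c] := eigenvalue_closed f mx_irr_degree_gt0.
exists c; apply/eqP; rewrite -subr_eq0; apply: contraTT f_c => f_neq.
have /(mx_Schur rG_irr)/(_ f_neq) : centgmx rG (f - c%:M).
  apply/centgmxP=> x Gx; rewrite mulmxBl mulmxBr scalar_mxC.
  by rewrite (centgmxP f_cent).
rewrite -row_free_unit -kermx_eq0 => /eqP f_inj.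
apply/eigenvalueP=> -[v v_eig /negP[]]; rewrite -submx0 -f_inj.
by apply/sub_kermxP; rewrite mulmxBr v_eig mul_mx_scalar subrr.
Qed.

Lemma closed_mx_abs_irr : mx_absolutely_irreducible rG.
Proof.
apply: (cent_mx_scalar_abs_irr rG_irr); rewrite leqNgt.
apply/(has_non_scalar_mxP (scalar_mx_cent _ _)) => -[f f_cent /is_scalar_mxP[]].
by apply: centgmx_scalar; rewrite -memmx_cent_envelop.
Qed.

(** By absolute irreducibility the [rG g] span all matrices, so [f] can be tested against the
    elementary ones. *)
Lemma trace_form_nondegenerate (f : 'M[C]_d) :
  {in G, forall g, \tr (f *m rG g) = 0} -> f = 0.
Proof.
move=> tr0; have [_ [a Da]] := mx_abs_irrP closed_mx_abs_irr.
have trB0 B : \tr (f *m B) = 0.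
  rewrite [B]Da mulmx_sumr raddf_sum big1 // => g Gg /=.
  by rewrite -scalemxAr mxtraceZ tr0 ?mulr0.
apply/matrixP=> i j; rewrite [RHS]mxE -(trB0 (delta_mx j i)) /mxtrace.
rewrite (bigD1 i) //= mxE (bigD1 j) //= mxE !eqxx mulr1 !big1 ?addr0 //.
  by move=> k /negPf ki; rewrite mxE big1 // => l _; rewrite mxE ki andbF mulr0.
by move=> k /negPf kj; rewrite mxE kj mulr0.
Qed.

(** The [rG g] span all matrices; for [d > 1] an off-diagonal elementary matrix would be scalar. *)
Lemma all_scalar_degree1 : {in G, forall g, is_scalar_mx (rG g)} -> d = 1%N.
Proof.
move=> rG_scal; have [_ [a Da]] := mx_abs_irrP closed_mx_abs_irr.
have scal (B : 'M[C]_d) : exists c, B = c%:M.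
  have /fin_all_exists[c Dc] (g : gT) : exists c, g \in G -> rG g = c%:M.
    have [Gg|] := boolP (g \in G); last by exists 0.
    by have /is_scalar_mxP[c ->] := rG_scal g Gg; exists c.
  exists (\sum_(g in G) a g B * c g); rewrite [LHS]Da raddf_sum.
  by apply: eq_bigr => g Gg; rewrite Dc // scale_scalar_mx.
have := mx_irr_degree_gt0; rewrite leq_eqVlt => /predU1P[//|d_gt1].
pose i0 := Ordinal mx_irr_degree_gt0; pose i1 := Ordinal d_gt1.
have [c /matrixP Dc] := scal (delta_mx i0 i1).
by have /eqP := Dc i0 i1; rewrite !mxE !eqxx oner_eq0.
Qed.

End ClosedFieldRepresentation.

(** Since ['X^k - 1] is separable, [f] is diagonalizable with roots of unity as eigenvalues, whose
    inverses are their conjugates. Powers are written with [iter] so that [d = 0] is covered. *)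
Lemma mxtrace_finite_order (C : numClosedFieldType) (d k : nat) (f f' : 'M[C]_d) :
  (0 < k)%N -> iter k (mulmx f) 1%:M = 1%:M -> f *m f' = 1%:M ->
  \tr f' = (\tr f)^*.
Proof.
case: d f f' => [|d] f f' k_gt0 fk ff'.
  by rewrite /mxtrace !big_ord0 conjC0.
have {}fk : f ^+ k = 1.
  by rewrite -[RHS]fk; elim: (k) => //= j IHj; rewrite exprS IHj.
have [rs Drs] := closed_field_poly_normal ('X^k - 1 : {poly C}).
have lc : lead_coef ('X^k - 1 : {poly C}) = 1.
  by apply/eqP; rewrite -[_ == _]/(_ \is monic) monicXnsubC.
have rs_uniq : uniq rs.
  rewrite -separable_prod_XsubC; rewrite lc scale1r in Drs; rewrite -Drs.
  by apply: separable_Xn_sub_1; rewrite pnatr_eq0 -lt0n.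
have [P P_unit /diagonalizable_forPex[D /(simmxP P_unit) PD]] : diagonalizable f.
  apply/diagonalizableP; exists rs => //; apply: mxminpoly_min.
  rewrite lc scale1r in Drs; rewrite -Drs rmorphB /= rmorphXn /= horner_mx_X fk.
  by rewrite rmorph1 subrr.
have tr_conj (g g' : 'M[C]_d.+1) : P *m g = g' *m P -> \tr g = \tr g'.
  move=> Pg; rewrite -[g](mulKmx P_unit) Pg mxtrace_mulC.
  by rewrite -mulmxA mulmxV ?mulmx1.
have D_pow i : D 0 i ^+ k = 1.
  have Pfj j : P *m f ^+ j = diag_mx (map_mx (fun x => x ^+ j) D) *m P.
    elim: j => [|j IHj].
      rewrite (_ : map_mx _ _ = const_mx 1) ?diag_const_mx ?mulmx1 ?mul1mx //.
      by apply/rowP=> l; rewrite !mxE.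
    rewrite exprS -[f * _]/(f *m _) mulmxA PD -mulmxA IHj mulmxA mulmx_diag.
    congr (diag_mx _ *m P); apply/rowP=> l; by rewrite !mxE exprS.
  have /(congr1 (mulmx^~ (invmx P))) := Pfj k.
  rewrite fk mulmx1 mulmxK // mulmxV // => /matrixP/(_ i i).
  by rewrite !mxE eqxx.
have D_conj i : (D 0 i)^* * D 0 i = 1.
  rewrite mulrC -normCK; have /eqP := congr1 Num.norm (D_pow i).
  by rewrite normrX normr1 pexpr_eq1 // => /eqP ->; rewrite expr1n.
have /tr_conj -> : P *m f' = diag_mx (map_mx Num.conj D) *m P.
  rewrite -{2}[P]mulmx1 -ff' [X in _ = _ *m X]mulmxA PD !mulmxA mulmx_diag.
  rewrite (_ : \row_j _ = const_mx 1) ?diag_const_mx ?mul1mx //.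
  by apply/rowP=> l; rewrite !mxE D_conj.
rewrite (tr_conj _ _ PD) !mxtrace_diag rmorph_sum.
by apply: eq_bigr => i _; rewrite mxE.
Qed.

Lemma repr_char_inv (C : numClosedFieldType) (gT : finGroupType) (G : {group gT})
    (d : nat) (rG : mx_representation C G d) (g : gT) :
  g \in G -> \tr (rG g^-1%g) = (\tr (rG g))^*.
Proof.
move=> Gg; apply: (mxtrace_finite_order (order_gt0 g)).
  have iter_g k : iter k (mulmx (rG g)) 1%:M = rG (g ^+ k)%g.
    elim: k => [|k IHk]; first by rewrite repr_mx1.
    by rewrite expgS repr_mxM ?groupX //= IHk.
  by rewrite iter_g expg_order repr_mx1.
by rewrite -repr_mxM ?groupV // mulgV repr_mx1.
Qed.

Lemma repr_charJ (C : fieldType) (gT : finGroupType) (G : {group gT})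
    (d : nat) (rG : mx_representation C G d) :
  {in G &, forall g y, \tr (rG (g ^ y)%g) = \tr (rG g)}.
Proof.
move=> g y Gg Gy; rewrite conjgE !repr_mxM ?groupM ?groupV //.
by rewrite mxtrace_mulC -mulmxA -repr_mxM ?groupV // mulgV repr_mx1 mulmx1.
Qed.

(** [M] commutes with [rG] because the character is a class function, so it is a scalar [c]. At
    [g = 1] the convolution is a sum of squared moduli with a positive term, whence [c != 0]. *)
Lemma irr_char_convolution (C : numClosedFieldType) (gT : finGroupType)
    (G : {group gT}) (d : nat) (rG : mx_representation C G d) :
  mx_irreducible rG ->
  exists2 c, c != 0 & {in G, forall g,
    \sum_(s in G) \tr (rG s) * \tr (rG (s^-1 * g)%g) = c * \tr (rG g)}.
Proof.
move=> rG_irr; pose M := \sum_(s in G) \tr (rG s) *: rG s^-1%g.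
have [c Dc] : exists c, M = c%:M.
  apply: (centgmx_scalar rG_irr); apply/centgmxP=> y Gy.
  rewrite mulmx_suml mulmx_sumr (reindex_inj (conjg_inj y^-1%g)) /=.
  apply: eq_big => [s|s]; rewrite groupJr ?groupV // => Gs.
  rewrite -scalemxAl -scalemxAr repr_charJ ?groupV //; congr (_ *: _).
  by rewrite -!repr_mxM ?groupV ?groupJ
    ?groupV // -conjVg conjgE invgK -!mulgA mulVg mulg1.
have conv g : g \in G ->
    \sum_(s in G) \tr (rG s) * \tr (rG (s^-1 * g)%g) = c * \tr (rG g).
  move=> Gg; rewrite -mxtraceZ -mul_scalar_mx -Dc mulmx_suml raddf_sum /=.
  by apply: eq_bigr => s Gs; rewrite -scalemxAl mxtraceZ -repr_mxM ?groupV.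
exists c => //; apply/eqP=> c0; have := conv 1%g (group1 G).
rewrite c0 mul0r; apply/eqP; rewrite gt_eqF // (bigD1 1%g) //=.
rewrite ltr_wpDr //.
  apply: sumr_ge0 => s /andP[Gs _].
  by rewrite mulg1 repr_char_inv // mul_conjC_ge0.
rewrite mulg1 repr_char_inv // mul_conjC_gt0 repr_mx1 mxtrace1 pnatr_eq0 -lt0n.
exact: mx_irr_degree_gt0 rG_irr.
Qed.

Section AbelianByAbelian.
Variables (C : numClosedFieldType) (gT : finGroupType) (G A H : {group gT}).
Hypotheses (AH_G : (A * H)%g = G) (abA : abelian A) (abH : abelian H).
Hypothesis nAH : (H \subset 'N(A))%g.
Variables (d : nat) (rG : mx_representation C G d).
Hypothesis rG_irr : mx_irreducible rG.

Let sAG a : a \in A -> a \in G.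
Proof. by move=> Aa; rewrite -AH_G -[a]mulg1 mem_mulg. Qed.

Let sHG h : h \in H -> h \in G.
Proof. by move=> Hh; rewrite -AH_G -[h]mul1g mem_mulg. Qed.

Let memAJ a h : a \in A -> h \in H -> (a ^ h)%g \in A.
Proof. by move=> Aa Hh; rewrite memJ_norm // (subsetP nAH). Qed.

Let memG_AH g : g \in G -> exists a h, [/\ a \in A, h \in H & g = (a * h)%g].
Proof. by rewrite -AH_G => /mulsgP[a h Aa Hh ->]; exists a, h. Qed.

Lemma centgmx_mul (f : 'M[C]_d) :
  {in A, forall a, f *m rG a = rG a *m f} ->
  {in H, forall h, f *m rG h = rG h *m f} ->
  exists c, f = c%:M.
Proof.
move=> fA fH; apply: (centgmx_scalar rG_irr);
  apply/centgmxP=> x /memG_AH[a [h [Aa Hh ->]]].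
by rewrite repr_mxM ?(sHG Hh) ?sAG // mulmxA fA // -mulmxA fH // mulmxA.
Qed.

(* The average of [rG a] over the conjugates of [a] under [H] is central. *)
Lemma char_abelian_normal (a : gT) : a \in A ->
  exists s : seq C, [/\ size s = #|H|, all #|A|.-unity_root s &
    #|H|%:R * \tr (rG a) = d%:R * \sum_(z <- s) z].
Proof.
move=> Aa.
have [v v_neq0 v_stable] : exists2 v : 'rV_d, v != 0 &
    all (fun f => stablemx v f) [seq rG b | b <- enum A].
  apply: (common_eigenvector (mx_irr_degree_gt0 rG_irr)).
  move=> _ _ /mapP[b + ->] /mapP[b' + ->]; rewrite !mem_enum => Ab Ab'.
  by rewrite /comm_mx -!repr_mxM ?sAG // (centsP abA).
have /fin_all_exists[l Dl] (b : gT) : exists c, b \in A -> v *m rG b = c *: v.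
  have [Ab|] := boolP (b \in A); last by exists 0.
  have /sub_rVP[c Dc] : (v *m rG b <= v)%MS.
    by apply: (allP v_stable (rG b)); rewrite map_f ?mem_enum.
  by exists c.
have l_unity b : b \in A -> l b ^+ #|A| = 1.
  move=> Ab; have v_pow k : v *m rG (b ^+ k)%g = l b ^+ k *: v.
    elim: k => [|k IHk]; first by rewrite repr_mx1 mulmx1 scale1r.
    rewrite expgSr repr_mxM ?sAG ?groupX // mulmxA IHk -scalemxAl Dl //.
    by rewrite scalerA -exprSr.
  apply/eqP; have := v_pow #|A|; rewrite expg_cardG //.
  rewrite repr_mx1 mulmx1 => /eqP; rewrite -subr_eq0 -{1}[v]scale1r -scalerBl.
  by rewrite scaler_eq0 (negPf v_neq0) orbF subr_eq0 eq_sym.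
exists [seq l (a ^ x)%g | x <- enum H]; split.
- by rewrite size_map -cardE.
- by apply/allP=> _ /mapP[x + ->]; rewrite mem_enum => Hx; apply/unity_rootP;
  rewrite l_unity ?memAJ.
pose M := \sum_(x in H) rG (a ^ x)%g.
have [c Dc] : exists c, M = c%:M.
  apply: centgmx_mul => [b Ab|h Hh]; rewrite mulmx_suml mulmx_sumr.
    by apply: eq_bigr => x Hx;
      rewrite -!repr_mxM ?sAG ?memAJ // (centsP abA) ?memAJ.
  rewrite [RHS](reindex_inj (mulIg h)) /=; apply: eq_big => [x|x Hx].
    by rewrite groupMr.
  by rewrite -!repr_mxM ?(sHG Hh) ?sAG ?memAJ ?groupM // conjgM conjgC.
(* Apply the scalar [M] to the common eigenvector [v]. *)
have -> : \sum_(z <- [seq l (a ^ x)%g | x <- enum H]) z = c.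
  have /eqP : v *m M = c *: v by rewrite Dc mul_mx_scalar.
  rewrite big_map big_enum /= mulmx_sumr.
  rewrite (eq_bigr (fun x => l (a ^ x)%g *: v)) => [|x Hx];
    last by rewrite Dl ?memAJ.
  rewrite -scaler_suml -subr_eq0 -scalerBl scaler_eq0 (negPf v_neq0) orbF subr_eq0.
  by move/eqP.
have := congr1 mxtrace Dc; rewrite mxtrace_scalar raddf_sum /=.
under eq_bigr => x Hx do rewrite (repr_charJ (G := G)) ?(sHG Hx) ?sAG //.
by rewrite sumr_const -[LHS]mulr_natl -[RHS]mulr_natl.
Qed.

Hypothesis H_span : ~ nat_span (primes #|A|) #|H|.

Lemma char_abelian_normal_neq0 (a : gT) : a \in A -> \tr (rG a) != 0.
Proof.
move=> Aa; apply/eqP=> tr0; have [s [s_size s_unity]] := char_abelian_normal Aa.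
rewrite tr0 mulr0 => /esym/eqP; rewrite mulf_eq0 pnatr_eq0 eqn0Ngt.
rewrite (mx_irr_degree_gt0 rG_irr) => /eqP s_sum0; apply: H_span.
by rewrite -s_size; apply: lam_leung s_sum0.
Qed.

(* The sum over [b] in [A] of [rG [~ h, b]] is central, and it is fixed by      *)
(* multiplication by each [rG [~ h, b]], one of which is not the identity; so   *)
(* it is [0].                                                                   *)
Lemma char_coset_eq0 (a h : gT) :
  a \in A -> h \in H -> ~~ is_scalar_mx (rG h) -> \tr (rG (a * h)%g) = 0.
Proof.
move=> Aa Hh h_nscal.
have memAR b : b \in A -> [~ h, b]%g \in A.
  by move=> Ab; rewrite commgEr groupM ?memAJ ?groupV.
pose M := \sum_(b in A) rG [~ h, b]%g.
have [c Dc] : exists c, M = c%:M.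
  apply: centgmx_mul => [b Ab|y Hy]; rewrite mulmx_suml mulmx_sumr.
    by apply: eq_bigr => x Ax;
      rewrite -!repr_mxM ?sAG ?memAR // (centsP abA) ?memAR.
  rewrite [RHS](reindex_inj (conjg_inj y)) /=; apply: eq_big => [b|b Ab].
    by rewrite memJ_norm ?(subsetP nAH).
  rewrite -!repr_mxM ?(sHG Hy) ?sAG ?memAR ?memAJ // conjgC conjRg.
  by rewrite [(h ^ y)%g]conjgE (centsP abH h) ?mulKg.
(* Otherwise [rG h] would commute with [rG] on both [A] and [H], hence be scalar. *)
have [b0 Ab0 b0_neq] : exists2 b, b \in A & rG [~ h, b]%g != 1%:M.
  apply/exists_inP; apply: contraR h_nscal => /exists_inPn all1.
  apply/is_scalar_mxP; apply: centgmx_mul => [b Ab|y Hy]; last first.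
    by rewrite -!repr_mxM ?sHG // (centsP abH).
  have /negbNE/eqP hb := all1 b Ab.
  rewrite -!repr_mxM ?(sHG Hh) ?(sAG Ab) // commgC.
  by rewrite (repr_mxM _ (groupM _ _) (sAG (memAR b Ab))) ?(sHG Hh)
    ?sAG // hb mulmx1.
have M0 : M = 0.
  have : rG [~ h, b0]%g *m M = M.
    rewrite mulmx_sumr [RHS](reindex_inj (mulIg b0)) /=; apply: eq_big => [b|b Ab].
      by rewrite groupMr.
    rewrite -repr_mxM ?sAG ?memAR // commgMJ; congr (rG (_ * _)%g).
    by rewrite conjgE (centsP abA _ _ b0) ?mulKg ?memAR.
  rewrite Dc mul_mx_scalar => /eqP;
    rewrite -subr_eq0 -{2}[c]mulr1 -scale_scalar_mx -scalerBr.
  by rewrite scaler_eq0 subr_eq0 (negPf b0_neq) orbF => /eqP ->; rewrite raddf0.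
have /eqP : #|A|%:R * \tr (rG (a * h)%g) = 0.
  (* As [A] is abelian, [a * h * [~ h, b]] is the conjugate of [a * h] by [b], so all terms have the
     same trace. *)
  transitivity (\tr (rG (a * h)%g *m M)); last by rewrite M0 mulmx0 mxtrace0.
  rewrite mulmx_sumr raddf_sum /= -sum1_card natr_sum mulr_suml.
  apply: eq_bigr => b Ab; rewrite mul1r -repr_mxM ?(sAG (memAR b Ab)) ?groupM
    ?(sHG Hh) ?sAG //.
  rewrite -(repr_charJ rG (groupM (sAG Aa) (sHG Hh)) (sAG Ab)).
  congr (\tr (rG _)); rewrite conjMg (conjg_mulR h) mulgA; congr (_ * _ * _)%g.
  by rewrite conjgE (centsP abA a) ?mulKg.
by rewrite mulf_eq0 pnatr_eq0 eqn0Ngt cardG_gt0 /= => /eqP.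
Qed.

Lemma char_neq0P (g : gT) : g \in G ->
  reflect (exists a h, [/\ a \in A, h \in H, g = (a * h)%g & is_scalar_mx (rG h)])
          (\tr (rG g) != 0).
Proof.
move=> Gg; apply: (iffP idP) => [g_neq0|[a [h [Aa Hh -> /is_scalar_mxP[c Dc]]]]].
  have [a [h [Aa Hh Dg]]] := memG_AH Gg; rewrite Dg in g_neq0 *.
  by exists a, h; split=> //; apply: contraNT g_neq0 => ?; rewrite char_coset_eq0.
rewrite repr_mxM ?(sHG Hh) ?sAG // Dc mul_mx_scalar mxtraceZ mulf_neq0 //.
  apply/eqP=> c0; have := repr_mx_free rG (sHG Hh).
  by rewrite Dc c0 raddf0 /row_free mxrank0 ltn_eqF // (mx_irr_degree_gt0 rG_irr).
exact: char_abelian_normal_neq0.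
Qed.

(** The product of [a * h] and [b * k] has [A]-part [a * b ^ h^-1] and [H]-part [h * k], and scalar
    matrices are closed under products. *)
Lemma char_neq0M (x y : gT) : x \in G -> y \in G ->
  \tr (rG x) != 0 -> \tr (rG y) != 0 -> \tr (rG (x * y)%g) != 0.
Proof.
move=> Gx Gy /(char_neq0P Gx)[a [h [Aa Hh -> /is_scalar_mxP[c Dc]]]].
move=> /(char_neq0P Gy)[b [k [Ab Hk -> /is_scalar_mxP[e De]]]].
apply/char_neq0P; first by rewrite !groupM ?(sAG Aa) ?(sAG Ab) ?sHG.
exists (a * b ^ h^-1)%g, (h * k)%g; split.
- by rewrite groupM ?memAJ ?groupV.
- by rewrite groupM.
- by rewrite conjgE invgK !mulgA mulgKV.
by rewrite repr_mxM ?sHG // Dc De -scalar_mxM scalar_mx_is_scalar.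
Qed.

Lemma degree1_of_scalar_normal : {in A, forall a, is_scalar_mx (rG a)} -> d = 1%N.
Proof.
move=> A_scal; apply: (all_scalar_degree1 rG_irr) => _ /memG_AH[a [h [Aa Hh ->]]].
have /is_scalar_mxP[c Dc] := A_scal a Aa.
have [e De] : exists e, rG h = e%:M.
  apply: centgmx_mul => [b Ab|y Hy].
    by have /is_scalar_mxP[f ->] := A_scal b Ab; rewrite scalar_mxC.
  by rewrite -!repr_mxM ?sHG // (centsP abH).
by rewrite repr_mxM ?(sHG Hh) ?sAG // Dc De -scalar_mxM scalar_mx_is_scalar.
Qed.
End AbelianByAbelian.

(** * Star tensors *)

Section PlaceFun.
Variables (m : nat) (T : Type).
Implicit Types (v : {ffun 'I_m -> T}) (s t : 'S_m).

Lemma place_fun1 v : place_fun v 1%g = v.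
Proof. by apply/ffunP=> i; rewrite ffunE invg1 perm1. Qed.

Lemma place_funM v s t : place_fun v (s * t)%g = place_fun (place_fun v s) t.
Proof. by apply/ffunP=> i; rewrite !ffunE invMg permM. Qed.

Lemma place_funK v s : place_fun (place_fun v s) s^-1%g = v.
Proof. by rewrite -place_funM mulgV place_fun1. Qed.
End PlaceFun.

Section StarTensor.
Variables (C : numClosedFieldType) (V : vectType C) (m n : nat).
Variables (ip : {dot V for Num.conj}) (W : tensor_power m ip) (e : n.-tuple V).
Hypothesis e_orthonormal : orthonormal ip e.
Variables (G : {group 'S_m}) (chi : 'S_m -> C).
Implicit Types (s t : 'S_m) (beta gamma delta : Gamma m n).

Local Notation bt := (basis_tensor W e).
Local Notation star := (star_tensor W G chi e).
Local Notation dot := (tp_dot W).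
Local Notation k0 := (chi 1%g / #|G|%:R).

Lemma place_perm_basis s gamma : place_perm W s (bt gamma) = bt (place_fun gamma s).
Proof.
by rewrite place_permE; congr (pure W _); apply/ffunP=> i; rewrite !ffunE.
Qed.

Lemma star_tensorE gamma :
  star gamma = k0 *: \sum_(s in G) chi s *: bt (place_fun gamma s).
Proof.
rewrite /star_tensor /symmetrizer scale_lfunE sum_lfunE; congr (_ *: _).
by apply: eq_bigr => s _; rewrite scale_lfunE place_perm_basis.
Qed.

Lemma basis_tensor_dot gamma delta : dot (bt gamma) (bt delta) = (gamma ==
  delta)%:R.
Proof.
have eE (j k : 'I_n) : ip (tnth e j) (tnth e k) = (j == k)%:R.
  case/orthonormalP: e_orthonormal => ue ->; try by rewrite mem_tnth.
  by rewrite !(tnth_nth 0) nth_uniq ?size_tuple.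
rewrite tp_dot_pure; under eq_bigr do rewrite !ffunE eE.
have [->|/eqP neq] := eqVneq; first by rewrite big1 // => i _; rewrite eqxx.
have [i ne_i] : exists i, gamma i != delta i.
  apply/existsP; apply: contraTT isT => /existsPn eq_i; case: neq.
  by apply/ffunP=> i; apply/eqP/negbNE.
by rewrite (bigD1 i) //= (negPf ne_i) mul0r.
Qed.

Lemma star_tensor_dot gamma delta :
  dot (star gamma) (star delta) = k0 * k0^* *
    \sum_(s in G) \sum_(t in G)
      chi s * (chi t)^* * (place_fun gamma s == place_fun delta t)%:R.
Proof.
rewrite !star_tensorE linearZl_LR linearZr_LR /= mulrA; congr (_ * _).
rewrite linear_sumlz /=; apply: eq_bigr => s _.
rewrite linearZl_LR linear_sumr /= mulr_sumr; apply: eq_bigr => t _.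
by rewrite linearZr_LR /= basis_tensor_dot mulrA.
Qed.

Lemma star_tensor_dot_orbit gamma delta :
  (forall s, s \in G -> delta != place_fun gamma s) ->
  dot (star gamma) (star delta) = 0.
Proof.
move=> no_s; rewrite star_tensor_dot big1 ?mulr0 // => s Gs;
  rewrite big1 // => t Gt.
case: eqP => [eq_st|_]; last by rewrite mulr0.
have /eqP[] := no_s (s * t^-1)%g (groupM Gs (groupVr Gt)).
by rewrite place_funM eq_st place_funK.
Qed.

Hypothesis e_basis : basis_of {:V}%VS e.

(** The complementary projection [p] kills the basis tensors, hence by multilinearity all pure
    tensors. Uniqueness in the universal property forces [p = 0]. *)
Lemma span_basis_tensor : <<codom bt>>%VS = fullv.
Proof.
set B := <<_>>%VS; pose p : 'End(W) := (\1 - projv B)%VF.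
have p_bt gamma : p (bt gamma) = 0.
  rewrite add_lfunE opp_lfunE id_lfunE projv_id ?subrr //.
  exact/memv_span/codom_f.
have p_pure : (fun v => p (pure W v)) =1 (fun _ => 0).
  apply: (multilinear_eq e_basis) => [v i c x y|v i c x y|gamma].
  - by rewrite pure_multilinear linearP.
  - by rewrite scaler0 addr0.
  exact: p_bt.
have zero_multi : multilinear (fun _ : {ffun 'I_m -> V} => 0 : W).
  by move=> v i c x y; rewrite scaler0 addr0.
have [g [_ g_uniq]] := pure_universal W zero_multi.
have p0 : p = 0.
  rewrite -(g_uniq p p_pure); apply: g_uniq => v.
  by rewrite zero_lfunE.
apply/vspaceP=> w; rewrite memvf.
have /eqP := congr1 (fun f : 'End(W) => f w) p0.
rewrite add_lfunE opp_lfunE id_lfunE zero_lfunE subr_eq0 => /eqP ->.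
exact: memv_proj.
Qed.

Lemma span_star_tensor : symmetry_class W G chi = <<codom star>>%VS.
Proof.
by rewrite /symmetry_class -span_basis_tensor limg_span /codom /image_mem -map_comp.
Qed.
End StarTensor.

Lemma orthogonal_span_eq0 (C : numClosedFieldType) (U : vectType C)
    (dot : {dot U for Num.conj}) (X : seq U) (w : U) :
  w \in <<X>>%VS -> {in X, forall x, dot w x = 0} -> w = 0.
Proof.
move=> wX w_orth; apply/eqP; rewrite -(dnorm_eq0 dot); apply/eqP.
rewrite {2}(coord_span (X := in_tuple X) wX) linear_sumr big1 // => i _.
by rewrite linearZr_LR /= w_orth ?mulr0 // mem_nth.
Qed.

(** * The orbit of a sequence with trivial stabilizer *)

Section RegularOrbit.
Variables (C : numClosedFieldType) (V : vectType C) (m n : nat).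
Variables (ip : {dot V for Num.conj}) (W : tensor_power m ip) (e : n.-tuple V).
Hypotheses (e_orthonormal : orthonormal ip e) (e_basis : basis_of {:V}%VS e).
Variables (G : {group 'S_m}) (chi : 'S_m -> C).
Variables (d : nat) (rG : mx_representation C G d).
Hypotheses (rG_irr : mx_irreducible rG) (chiE : {in G, forall g, chi g = \tr
  (rG g)}).
Variable alpha : Gamma m n.
Hypothesis alpha_stab : stab_seq G alpha = [set 1%g].

Local Notation star := (star_tensor W G chi e).
Local Notation dot := (tp_dot W).

Lemma place_fun_regular : {in G &, injective (place_fun alpha)}.
Proof.
move=> x y Gx Gy xy; apply/eqP; rewrite eq_mulgV1 -in_set1 -alpha_stab.
by rewrite inE groupM ?groupV //= place_funM xy place_funK.
Qed.

Lemma star_tensor_dot_regular :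
  exists2 c, c != 0 & {in G &, forall x y,
    dot (star (place_fun alpha x)) (star (place_fun alpha y)) =
      c * \tr (rG (x^-1 * y)%g)}.
Proof.
have [c c_neq0 conv] := irr_char_convolution rG_irr.
pose k := chi 1%g / #|G|%:R; have k_neq0 : k != 0.
  rewrite mulf_neq0 ?invr_neq0 ?pnatr_eq0 -?lt0n ?cardG_gt0 //.
  by rewrite chiE // repr_mx1 mxtrace1 pnatr_eq0 -lt0n (mx_irr_degree_gt0 rG_irr).
exists (k * k^* * c) => [|x y Gx Gy];
  first by rewrite mulf_neq0 // mulf_neq0 ?conjC_eq0.
rewrite (star_tensor_dot _ e_orthonormal) -/k -[RHS]mulrA -conv ?groupM ?groupV //.
(* By regularity, only [t = y^-1 * x * s] contributes for a given [s]; what remains is the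
   convolution of the character with itself at [x^-1 * y]. *)
congr (_ * _); apply: eq_bigr => s Gs; rewrite (bigD1 (y^-1 * x * s)%g) /=;
  last first.
  by rewrite !groupM ?groupV.
rewrite -!place_funM !mulgA mulgV mul1g eqxx mulr1 big1 ?addr0
  => [|t /andP[Gt t_neq]].
  rewrite !chiE ?groupM ?groupV // -(repr_char_inv rG) ?groupM ?groupV //.
  by rewrite !invMg invgK mulgA.
rewrite -place_funM (inj_in_eq place_fun_regular) ?groupM //.
have -> : (x * s == y * t)%g = false; last by rewrite mulr0.
by apply: contraNF t_neq => /eqP xs; rewrite -mulgA xs mulKg.
Qed.

Lemma star_tensor_regular_neq0 x : x \in G -> star (place_fun alpha x) != 0.
Proof.
move=> Gx; have [c c_neq0 dotE] := star_tensor_dot_regular.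
rewrite -(dnorm_eq0 dot) dotE // mulVg mulf_neq0 //.
by rewrite repr_mx1 mxtrace1 pnatr_eq0 -lt0n (mx_irr_degree_gt0 rG_irr).
Qed.

Variables A H : {group 'S_m}.
Hypotheses (AH_G : (A * H)%g = G) (abA : abelian A) (abH : abelian H).
Hypothesis nAH : (H \subset 'N(A))%g.
Hypothesis H_span : ~ nat_span (primes #|A|) #|H|.
Hypothesis ostar : has_ostar_basis W G chi e.

(* Since [chi (x^-1 y) != 0] is an equivalence relation on [G], exactly one     *)
(* element of the basis is not orthogonal to a given star tensor of the orbit.  *)
Lemma ostar_basis_orbit : exists s : seq (Gamma m n),
  {in G, forall g, exists x,
    [/\ x \in G, place_fun alpha x \in s, \tr (rG (g^-1 * x)%g) != 0
      & exists c, star (place_fun alpha g) = c *: star (place_fun alpha x)]} /\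
  {in s &, forall gamma delta,
    dot (star gamma) (star delta) != 0 -> star gamma = star delta}.
Proof.
have [s [/= /andP[/eqP X_span _] X_orth]] := ostar; exists s.
have [c c_neq0 dotE] := star_tensor_dot_regular.
have s_orth : {in s &, forall gamma delta,
    dot (star gamma) (star delta) != 0 -> star gamma = star delta}.
  have /pairwise_orthogonalP[_ orth] := X_orth.
  move=> gamma delta s_gamma s_delta; apply: contraNeq => neq.
  by rewrite orth ?map_f.
split=> // g Gg; set X := [seq star gamma | gamma <- s] in X_span X_orth.
have star_X gamma : star gamma \in <<X>>%VS.
  by rewrite X_span (span_star_tensor _ _ _ e_basis) memv_span ?codom_f.
have [x /and3P[Gx s_x gx_neq0]] : exists x,
    [&& x \in G, place_fun alpha x \in s & \tr (rG (g^-1 * x)%g) != 0].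
  apply/existsP; apply: contraNT (star_tensor_regular_neq0 Gg) => /existsPn no_x.
  apply/eqP/(orthogonal_span_eq0 (dot := dot) (star_X _)) => _ /mapP[gamma
    s_gamma ->].
  have [/exists_inP[x Gx /eqP Dx]|] := boolP [exists x in G, gamma == place_fun
    alpha x].
    rewrite Dx dotE //; have := no_x x; rewrite Gx -Dx s_gamma /= negbK => /eqP ->.
    by rewrite mulr0.
  move=> /exists_inPn no_orbit;
    apply: (star_tensor_dot_orbit _ e_orthonormal) => t Gt.
  have := no_orbit (g * t)%g (groupM Gg Gt); by rewrite place_funM.
exists x; split=> //.
set u := star _; set v := star _.
have vv : dot v v != 0 by rewrite dnorm_eq0 star_tensor_regular_neq0.
(* Subtract from [u] its projection on [v]; the difference lies in the span of [X] and will be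
   orthogonal to all of [X], hence zero. *)
exists (dot u v / dot v v); apply/eqP; rewrite -subr_eq0; apply/eqP.
apply: (orthogonal_span_eq0 (dot := dot) (X := X)).
  by rewrite rpredB ?rpredZ ?star_X.
move=> _ /mapP[gamma s_gamma ->]; rewrite linearBl /= linearZl_LR /=.
have [<-|/eqP neq] := v =P star gamma; first by rewrite divfK ?subrr.
have -> : dot v (star gamma) = 0.
  by apply: contraNeq neq => v_gamma; apply/eqP/s_orth.
rewrite mulr0 subr0.
have [/exists_inP[y Gy /eqP Dy]|] := boolP [exists x in G, gamma == place_fun
  alpha x].
  (* If [u] is not orthogonal to [star gamma], the character is nonzero at [g^-1 * x] and
     [g^-1 * y], hence at [x^-1 * y]; so [v] and [star gamma] are not orthogonal and coincide. *)
  apply: contraNeq neq; rewrite /u Dy dotE // mulf_eq0 negb_or => /andP[_ gy].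
  apply/eqP/s_orth; rewrite -?Dy // Dy dotE // mulf_neq0 //.
  have -> : (x^-1 * y = (g^-1 * x)^-1 * (g^-1 * y))%g by rewrite invMg invgK
    mulgA mulgK.
  apply: (char_neq0M AH_G abA abH nAH rG_irr H_span) => //;
    rewrite ?groupV ?groupM ?groupV //.
  by rewrite repr_char_inv ?groupM ?groupV // conjC_eq0.
move=> /exists_inPn no_orbit;
  apply: (star_tensor_dot_orbit _ e_orthonormal) => t Gt.
by have := no_orbit (g * t)%g (groupM Gg Gt); rewrite place_funM.
Qed.

(** The sequences [alpha] and its translate by [a^-1] lie in one coset of the support, so their star
    tensors are proportional. Pairing with the translate by [t] shows that the character at [a * t]
    is a fixed multiple of its value at [t]; nondegeneracy of the trace form makes [rG a] scalar. *)
Lemma ostar_basis_linear : d = 1%N.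
Proof.
apply: (degree1_of_scalar_normal AH_G abH rG_irr) => a Aa.
have sAG b : b \in A -> b \in G by move=> Ab; rewrite -AH_G -[b]mulg1 mem_mulg.
have charM := char_neq0M AH_G abA abH nAH rG_irr H_span.
have charV x : x \in G -> \tr (rG x) != 0 -> \tr (rG x^-1%g) != 0.
  by move=> Gx; rewrite repr_char_inv // conjC_eq0.
have char_A := char_abelian_normal_neq0 AH_G abA nAH rG_irr H_span.
have [c0 c0_neq0 dotE] := star_tensor_dot_regular.
have [s [s_orbit s_orth]] := ostar_basis_orbit.
have Aa' : (a^-1)%g \in A by rewrite groupV.
have [x [Gx s_x chi_x [c Dc]]] := s_orbit 1%g (group1 G).
have [y [Gy s_y chi_y [c' Dc']]] := s_orbit (a^-1)%g (sAG _ Aa').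
rewrite invg1 mul1g in chi_x; rewrite invgK in chi_y.
have chi_y' : \tr (rG y) != 0.
  by rewrite -[y](mulKg a); apply: charM (char_A _ Aa') chi_y;
    rewrite ?groupM ?groupV ?(sAG a).
have eq_xy : star (place_fun alpha x) = star (place_fun alpha y).
  by apply: s_orth => //; rewrite dotE // mulf_neq0 // charM ?groupV ?charV.
have c_neq0 : c != 0.
  apply: contraNneq (star_tensor_regular_neq0 (group1 G)) => c_eq0.
  by rewrite Dc c_eq0 scale0r.
have D : star (place_fun alpha a^-1%g) = (c' / c) *: star (place_fun alpha 1%g).
  by rewrite Dc Dc' eq_xy scalerA divfK.
apply/is_scalar_mxP; exists (c' / c); apply/eqP; rewrite -subr_eq0; apply/eqP.
apply: (trace_form_nondegenerate rG_irr) => t Gt.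
rewrite mulmxBl mul_scalar_mx raddfB /= mxtraceZ -repr_mxM ?(sAG a) //.
apply: (mulfI c0_neq0); rewrite mulr0 mulrBr.
have <- : dot (star (place_fun alpha a^-1%g)) (star (place_fun alpha t)) =
   c0 * \tr (rG (a * t)%g) by rewrite (dotE _ _ (sAG _ Aa') Gt) invgK.
by rewrite D linearZl_LR /= dotE // invg1 mul1g mulrCA subrr.
Qed.
End RegularOrbit.

(** * Linear characters admit an orthogonal *-basis *)

Section LinearCharacter.
Variables (C : numClosedFieldType) (V : vectType C) (m n : nat).
Variables (ip : {dot V for Num.conj}) (W : tensor_power m ip) (e : n.-tuple V).
Hypotheses (e_orthonormal : orthonormal ip e) (e_basis : basis_of {:V}%VS e).
Variables (G : {group 'S_m}) (chi : 'S_m -> C).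
Hypothesis chiM : {in G &, {morph chi : x y / (x * y)%g >-> x * y}}.

Local Notation star := (star_tensor W G chi e).

Lemma star_tensor_place (gamma : Gamma m n) (x : 'S_m) : x \in G ->
  star (place_fun gamma x) = chi x^-1%g *: star gamma.
Proof.
move=> Gx; rewrite !star_tensorE scalerA [chi x^-1%g * _]mulrC -[RHS]scalerA;
  congr (_ *: _).
rewrite scaler_sumr [RHS](reindex_inj (mulgI x)) /=.
apply: eq_big => [s|s Gs]; first by rewrite groupMl.
by rewrite scalerA -chiM ?groupM ?groupV // mulKg place_funM.
Qed.

Lemma linear_ostar_basis : has_ostar_basis W G chi e.
Proof.
pose orb (gamma : Gamma m n) := [set place_fun gamma x | x in G].
(* The pick depends only on the orbit as a set, so [rep] is constant on orbits; the default is never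
   reached, as [gamma] lies in its own orbit. *)
pose rep gamma := odflt gamma [pick delta in orb gamma].
have rep_orb gamma : exists2 x, x \in G & rep gamma = place_fun gamma x.
  rewrite /rep; case: pickP => [delta /imsetP[x Gx ->]|/(_ gamma)];
    first by exists x.
  by move=> /negP[]; apply/imsetP; exists 1%g; rewrite ?place_fun1.
have rep_place gamma x : x \in G -> rep (place_fun gamma x) = rep gamma.
  move=> Gx; rewrite /rep (_ : orb (place_fun gamma x) = orb gamma).
    case: pickP => // /(_ gamma) /negP[].
    by apply/imsetP; exists 1%g; rewrite ?place_fun1.
  apply/setP=> delta; apply/imsetP/imsetP=> -[y Gy ->].
    by exists (x * y)%g; rewrite ?groupM ?place_funM.
  by exists (x^-1 * y)%g; rewrite ?groupM ?groupV // -place_funM mulKVg.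
pose s := [seq gamma <- enum {: Gamma m n} | (rep gamma == gamma) && (star
  gamma != 0)].
exists s => /=; set X := map _ _.
have s_orth gamma delta : gamma \in s -> delta \in s -> gamma != delta ->
    tp_dot W (star gamma) (star delta) = 0.
  rewrite !mem_filter => /andP[/andP[/eqP rep_g _] _] /andP[/andP[/eqP rep_d _]
    _] neq.
  apply: (star_tensor_dot_orbit _ e_orthonormal) => x Gx;
    apply: contraNneq neq => Dd.
  by rewrite -rep_g -rep_d Dd rep_place.
have s_neq0 gamma : gamma \in s -> star gamma != 0.
  by rewrite mem_filter => /andP[/andP[]].
have X_orth : pairwise_orthogonal (tp_dot W) X.
  apply/pairwise_orthogonalP;
    split=> [|_ _ /mapP[gamma sg ->] /mapP[delta sd ->] neq].
    rewrite /= map_inj_in_uniq ?(filter_uniq _ (enum_uniq _)) ?andbT.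
      by apply/mapP=> -[gamma /s_neq0 + /esym/eqP]; rewrite -eqbF_neg => /eqP ->.
    (* Equal star tensors at distinct members of [s] would be orthogonal to themselves, hence
       zero. *)
    move=> gamma delta sg sd eq_star; apply/eqP;
      apply: contraTT (s_neq0 _ sg) => neq.
    by rewrite negbK -(dnorm_eq0 (tp_dot W)) {2}eq_star s_orth.
  by apply: s_orth => //; apply: contra_neq neq => ->.
split=> //; rewrite /basis_of (orthogonal_free X_orth) andbT.
rewrite (span_star_tensor _ _ _ e_basis) eqEsubv; apply/andP; split;
  apply/span_subvP.
  by move=> _ /mapP[gamma _ ->]; rewrite memv_span ?codom_f.
move=> _ /codomP[gamma ->]; have [x Gx Dx] := rep_orb gamma.
have -> : gamma = place_fun (rep gamma) x^-1%g by rewrite Dx place_funK.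
rewrite star_tensor_place ?groupV // rpredZ //.
have [->|star_neq0] := eqVneq (star (rep gamma)) 0; first exact: mem0v.
by rewrite memv_span // map_f // mem_filter star_neq0 mem_enum andbT {1}Dx
  rep_place ?eqxx.
Qed.
End LinearCharacter.

(** * Internal factors of the semidirect product, and the theorem *)

Lemma isog_sdprod_factors (aT hT gT : finGroupType) (A : {group aT}) (H :
  {group hT})
    (phi : {morphism H >-> {perm aT}}) (G : {group gT}) :
  (phi @* H)%g \subset Aut A -> isog_sdprod A phi G ->
  exists A1 H1 : {group gT},
    [/\ (A1 * H1)%g = G, (H1 \subset 'N(A1))%g, (A1 \isog A)%g & (H1 \isog H)%g].
Proof.
move=> phi_Aut [f [f_inj f_im fM]].
have phiA h : h \in H -> phi h \in Aut A.
  by move=> Hh; rewrite (subsetP phi_Aut) ?mem_morphim.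
have phi_1 h : h \in H -> phi h 1%g = 1%g.
  by move=> Hh; rewrite -(autmE (phiA h Hh)) morph1.
have inX a h : a \in A -> h \in H -> (a, h) \in setX A H.
  by rewrite in_setX /= => -> ->.
have f_mul a h b k : a \in A -> h \in H -> b \in A -> k \in H ->
    (f (a, h) * f (b, k))%g = f (a * phi h b, h * k)%g.
  by move=> Aa Hh Ab Hk; rewrite -fM ?inX.
have fA_M : {in A &, {morph (fun a => f (a, 1%g)) : a b / (a * b)%g}}.
  by move=> a b Aa Ab; rewrite f_mul // morph1 perm1 mulg1.
have fH_M : {in H &, {morph (fun h => f (1%g, h)) : h k / (h * k)%g}}.
  by move=> h k Hh Hk; rewrite f_mul // phi_1 // mulg1.
pose fA := Morphism fA_M; pose fH := Morphism fH_M.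
have fA_inj : ('injm fA)%g.
  by apply/injmP=> a b Aa Ab /f_inj; rewrite !inX // => /(_ isT isT)[].
have fH_inj : ('injm fH)%g.
  by apply/injmP=> h k Hh Hk /f_inj; rewrite !inX // => /(_ isT isT)[].
exists (fA @* A)%G, (fH @* H)%G; split=> /=.
- apply/setP=> g; rewrite -f_im; apply/mulsgP/imsetP.
    move=> [_ _ /morphimP[a _ Aa ->] /morphimP[h _ Hh ->] ->].
    by exists (a, h); rewrite ?inX //= f_mul // morph1 perm1 mulg1 mul1g.
  move=> [[a h]]; rewrite in_setX /= => /andP[Aa Hh] ->.
  exists (fA a) (fH h); rewrite ?mem_morphim //=.
  by rewrite f_mul // morph1 perm1 mulg1 mul1g.
(* Passing to the inverse turns conjugation by [f (1, h)] into the action [a] to [phi h a]. *)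
- apply/subsetP=> _ /morphimP[h _ Hh ->]; rewrite -groupV inE.
  apply/subsetP=> _ /imsetP[_ /morphimP[a _ Aa ->] ->].
  have Aha : phi h a \in A by rewrite Aut_closed ?phiA.
  rewrite (_ : (_ ^ _)%g = fA (phi h a)) ?mem_morphim //.
  rewrite conjgE invgK mulgA; apply: (canLR (mulgK _)) => /=.
  by rewrite !f_mul // mul1g !mulg1 morph1 perm1 mulg1 mul1g.
- by rewrite isog_sym sub_isog.
by rewrite isog_sym sub_isog.
Qed.

Theorem theorem4p1 (R : realType)
    (aT hT : finGroupType) (A : {group aT}) (H : {group hT})
    (abA : abelian A) (abH : abelian H)
    (phi : {morphism H >-> {perm aT}}) (phi_Aut : (phi @* H)%g \subset Aut A)
    (m n : nat) (n_gt1 : (1 < n)%N)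
    (G : {group 'S_m}) (G_sdprod : isog_sdprod A phi G)
    (V : vectType R[i]) (ip : {dot V for Num.conj}) (e : n.-tuple V)
    (e_basis : basis_of {:V}%VS e) (e_orthonormal : orthonormal ip e)
    (W : tensor_power m ip)
    (chi : 'S_m -> R[i]) (chi_irr : irr_character G chi)
    (alpha_stab : exists alpha : Gamma m n, stab_seq G alpha = [set 1%g])
    (H_span : ~ nat_span (primes #|A|) #|H|) :
  has_ostar_basis W G chi e <-> chi 1%g = 1.
Proof.
have [d [rG [rG_irr chiE]]] := chi_irr; have [alpha alpha_regular] := alpha_stab.
have chi1 : chi 1%g = d%:R by rewrite chiE // repr_mx1 mxtrace1.
split=> [ostar|].
  have [A1 [H1 [AH_G nAH isoA isoH]]] := isog_sdprod_factors phi_Aut G_sdprod.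
  have abA1 : abelian A1 by rewrite (isog_abelian isoA).
  have abH1 : abelian H1 by rewrite (isog_abelian isoH).
  have H_span1 : ~ nat_span (primes #|A1|) #|H1|.
    by rewrite (card_isog isoA) (card_isog isoH).
  rewrite chi1; apply/eqP; rewrite pnatr_eq1; apply/eqP.
  exact: (ostar_basis_linear e_orthonormal e_basis rG_irr chiE alpha_regular
    AH_G abA1 abH1 nAH H_span1 ostar).
(* In degree one the trace is the single matrix entry, so [chi] is multiplicative on [G]. *)
rewrite chi1 => /eqP; rewrite pnatr_eq1 => /eqP d1; subst d.
apply: linear_ostar_basis => // x y Gx Gy.
by rewrite !chiE ?groupM // repr_mxM // !trace_mx11 mxE big_ord1.
Qed.
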